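(* There is a goods instance with three agents and nine goods in which every valuation is additive and strictly positive (every good has strictly positive value for every agent), which admits no exact PMMS allocation, and whose optimal PMMS factor $\alpha^\star(I)$ is exactly $226/227$. Consequently, $\alpha^{\star}_{\mathrm{PMMS}}\le\frac{226}{227}<1$.
   Context: An additive goods instance consists of a finite set $N=[n]$ of agents, a finite set $M$ of indivisible goods, and for each agent $i$ an additive valuation $v_i:2^M\to\mathbb{R}_{\ge0}$. An allocation $X=(X_i)_{i\in N}$ is a partition of $M$ into $n$ (possibly empty) bundles. For $S\subseteq M$, $\mu^{\mathrm G}_i(2,S)=\max_{(P_1,P_2)\in\Pi_2(S)}\min\{v_i(P_1),v_i(P_2)\}$, where $\Pi_2(S)$ is the set of ordered bipartitions of $S$ (parts may be empty). An allocation $X$ is $\alpha$-PMMS if $v_i(X_i)\ge\alpha\,\mu^{\mathrm G}_i(2,X_i\cup X_j)$ for all $i\ne j$, and exact PMMS if it is $1$-PMMS. The PMMS factor of an allocation is $\alpha(X)=\min\{v_i(X_i)/\mu^{\mathrm G}_i(2,X_i\cup X_j): i\ne j,\ \mu^{\mathrm G}_i(2,X_i\cup X_j)>0\}$ (with the minimum over an empty set taken to be $+\infty$); the optimal PMMS factor (ratio) of an instance $I$ is $\alpha^\star(I)=\max_X\alpha(X)$ over all allocations; and $\alpha^{\star}_{\mathrm{PMMS}}=\inf_I\alpha^\star(I)$ over all additive goods instances $I$. *)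

(* Defs.v *)
From mathcomp Require Import all_boot all_order all_algebra.
From mathcomp Require Import boolp classical_sets reals constructive_ereal ereal.

Set Implicit Arguments.
Unset Strict Implicit.
Unset Printing Implicit Defensive.

Import Order.TTheory GRing.Theory Num.Theory.

Local Open Scope ring_scope.

(* At least one agent is required, so that allocations exist and the maximum
   in [opt_factor] is taken over a nonempty set. *)
Record instance (R : realType) := Instance {
  nagents : nat;
  nagents_gt0 : (0 < nagents)%N;
  goods : finType;
  valuation : 'I_nagents -> {set goods} -> R;
  valuation_ge0 : forall i (S : {set goods}), 0 <= valuation i S;
  valuation_additive : forall i (S : {set goods}),
    valuation i S = \sum_(g in S) valuation i [set g]%SET
}.

Section PMMS.
Variables (R : realType) (I : instance R).
Implicit Types (S : {set goods I}) (i : 'I_(nagents I))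
  (X : {ffun 'I_(nagents I) -> {set goods I}}) (a : R).

Definition is_allocation X : bool :=
  (\bigcup_i X i == [set: goods I])%SET &&
  [forall i, forall j, (i != j) ==> [disjoint X i & X j]].

Definition is_bipartition S (P : {set goods I} * {set goods I}) : bool :=
  (P.1 :|: P.2 == S)%SET && [disjoint P.1 & P.2].

(* The default value 0 of the maximum is harmless: (S, set0) is a bipartition
   of S, and valuations are nonnegative. *)
Definition mu2 i S : R :=
  \big[Num.max/0]_(P | is_bipartition S P)
    Num.min (valuation i P.1) (valuation i P.2).

Definition is_PMMS a X : Prop :=
  forall i j, i != j ->
    a * mu2 i (X i :|: X j)%SET <= valuation i (X i).

Definition exact_PMMS X : Prop := is_PMMS 1 X.

Definition PMMS_factor X : \bar R :=
  \big[Order.min/+oo%E]_(p : 'I_(nagents I) * 'I_(nagents I) |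
      (p.1 != p.2) && (0 < mu2 p.1 (X p.1 :|: X p.2)%SET))
    (valuation p.1 (X p.1) / mu2 p.1 (X p.1 :|: X p.2)%SET)%:E.

Definition opt_factor : \bar R :=
  \big[Order.max/-oo%E]_(X | is_allocation X) PMMS_factor X.

End PMMS.

Definition alpha_star_PMMS (R : realType) : \bar R :=
  ereal_inf [set x | exists I : instance R, x = opt_factor I]%classic.

(* Main.v *)
Require Import Defs.
From Stdlib Require Import BinNat.
From mathcomp Require Import all_boot all_order all_algebra.
From mathcomp Require Import boolp classical_sets reals constructive_ereal ereal.
From mathcomp Require Import zify lra.

(** The instance is explicit: the valuations [weights] below, found by numerical
    search, have optimal factor 226/227. That no allocation does better is a
    finite check over the 3^9 allocations, each of which contains an agent [i]
    and another agent [j] with 227 v_i(X_i) <= 226 mu_i(X_i U X_j). To keep it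
    small, the values mu_i(U) of all 2^9 sets of goods are stored in a binary
    trie branching on membership of the successive goods in U, and the goods
    are handed out one at a time, descending all tries simultaneously. *)

Set Implicit Arguments.
Unset Strict Implicit.
Unset Printing Implicit Defensive.

Import Order.TTheory GRing.Theory Num.Theory.

Local Open Scope ring_scope.

(** * Sets of goods as bit sequences *)

Section Charvec.
Variable n : nat.
Implicit Types P Q : pred 'I_n.

Definition charvec P : bitseq := [seq P g | g <- enum 'I_n].

Lemma size_charvec P : size (charvec P) = n.
Proof. by rewrite size_map size_enum_ord. Qed.

Lemma nth_charvec P (g : 'I_n) : nth false (charvec P) g = P g.
Proof. by rewrite (nth_map g) ?size_enum_ord // nth_ord_enum. Qed.

Lemma eq_charvec P Q : P =1 Q -> charvec P = charvec Q.
Proof. by move=> PQ; apply: eq_map. Qed.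

Lemma charvecE (b : bitseq) P : size b = n ->
  (forall g : 'I_n, nth false b g = P g) -> b = charvec P.
Proof.
move=> sz bP; apply: (@eq_from_nth _ false); rewrite ?size_charvec // sz => k kn.
by rewrite (bP (Ordinal kn)) -(nth_charvec P (Ordinal kn)).
Qed.

End Charvec.

Lemma charvecS n (P : pred 'I_n.+1) :
  charvec P = P ord0 :: charvec (fun g => P (lift ord0 g)).
Proof. by rewrite /charvec enum_ordSl /= -map_comp. Qed.

(** Loads are binary numbers, so that the exhaustive check evaluates quickly; statements about them
    go through the coercion to [nat]. *)
Fixpoint load (ws : seq N) (b : bitseq) : N :=
  match ws, b with
  | w :: ws', x :: b' => N.add (if x then w else 0%num) (load ws' b')
  | _, _ => 0%num
  end.

Lemma load_charvec n ws (P : pred 'I_n) :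
  load ws (charvec P) = (\sum_(g < n | P g) nth 0%num ws g)%N :> nat.
Proof.
rewrite big_mkcond /=; elim: n ws P => [|n IHn] [|w ws] P.
- by rewrite big_ord0.
- by rewrite /charvec enum_ord0 big_ord0.
- by rewrite big1 // => g _; rewrite nth_nil; case: ifP.
- have addE (a b : N) : N.add a b = (a + b)%N :> nat by lia.
  rewrite charvecS big_ord_recl /= addE IHn; congr addn.
  by case: (P ord0).
Qed.

(** * Enumeration of the load pairs of bipartitions *)

Fixpoint splits (ws : seq N) (u : bitseq) (l : seq (N * N)) : seq (N * N) :=
  match ws, u with
  | w :: ws', b :: u' => splits ws' u'
      (if b then [seq (N.add p.1 w, p.2) | p <- l] ++
                 [seq (p.1, N.add p.2 w) | p <- l] else l)
  | _, _ => l
  end.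

Definition meetb (u b : bitseq) : bitseq := [seq p.1 && p.2 | p <- zip u b].
Definition diffb (u b : bitseq) : bitseq := [seq p.1 && ~~ p.2 | p <- zip u b].

Lemma meetb_charvec n (P Q : pred 'I_n) :
  meetb (charvec P) (charvec Q) = charvec (fun g => P g && Q g).
Proof. by rewrite /meetb /charvec zip_map -map_comp. Qed.

Lemma diffb_charvec n (P Q : pred 'I_n) :
  diffb (charvec P) (charvec Q) = charvec (fun g => P g && ~~ Q g).
Proof. by rewrite /diffb /charvec zip_map -map_comp. Qed.

(** Each good of [u] goes to the first or the second part, and [b] records this choice; [l] holds
    the loads accumulated so far. *)
Lemma splits_mem ws u b l p : p \in l -> size u = size ws -> size b = size ws ->
  (N.add p.1 (load ws (meetb u b)), N.add p.2 (load ws (diffb u b)))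
    \in splits ws u l.
Proof.
elim: ws u b l p => [|w ws IHws] [|x u] [|y b] l [p1 p2] //=.
  by move=> pl _ _; rewrite !N.add_0_r.
move=> pl [szu] [szb]; case: x => /=; last exact: (IHws u b l (p1, p2)).
case: y => /=.
- rewrite N.add_assoc; apply: (IHws u b _ (N.add p1 w, p2)) => //.
  by rewrite mem_cat (map_f (fun p => (N.add p.1 w, p.2)) pl).
- rewrite N.add_assoc; apply: (IHws u b _ (p1, N.add p2 w)) => //.
  by rewrite mem_cat (map_f (fun p => (p.1, N.add p.2 w)) pl) orbT.
Qed.

Lemma splits_inv ws u l x : x \in splits ws u l -> size u = size ws ->
  exists2 p, p \in l & exists2 b, size b = size ws &
    x = (N.add p.1 (load ws (meetb u b)), N.add p.2 (load ws (diffb u b))).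
Proof.
elim: ws u l => [|w ws IHws] [|y u] l //=.
  move=> xl _; exists x => //; exists [::] => //=.
  by rewrite !N.add_0_r; case: x {xl}.
move=> xl [szu]; have [p pl [b szb ->]] := IHws _ _ xl szu.
case: y xl pl => /= _; last first.
  (* The good is outside [u], so its bit in [b] is arbitrary. *)
  by move=> pl; exists p => //; exists (true :: b); rewrite //= szb.
rewrite mem_cat => /orP[] /mapP[q ql ->]; exists q => //.
- by exists (true :: b); rewrite /= ?szb // N.add_assoc.
- by exists (false :: b); rewrite /= ?szb // N.add_assoc.
Qed.

Definition maximin (l : seq (N * N)) : N :=
  foldr (fun p m => N.max (N.min p.1 p.2) m) 0%num l.

Lemma maximin_ge l p : p \in l -> (N.min p.1 p.2 <= maximin l)%N.
Proof.
elim: l => //= q l IHl; rewrite inE => /predU1P[->|/IHl]; lia.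
Qed.

(** The first alternative is the initial value of the fold, which agrees with the default value of
    [mu2]. *)
Lemma maximin_attained l : maximin l = 0%num \/
  exists2 p, p \in l & maximin l = N.min p.1 p.2.
Proof.
elim: l => [|q l IHl]; first by left.
have [->|->] : maximin (q :: l) = N.min q.1 q.2 \/ maximin (q :: l) = maximin l
  by rewrite /=; lia.
- by right; exists q; rewrite ?mem_head.
- case: IHl => [->|[p pl ->]]; [by left | right].
  by exists p; rewrite // inE pl orbT.
Qed.

(** * Tries of maximin values *)

Inductive trie := Leaf of N | Node of trie & trie.

Definition child (t : trie) (b : bool) : trie :=
  match t with Leaf _ => t | Node t0 t1 => if b then t1 else t0 end.

Definition root_value (t : trie) : N := if t is Leaf m then m else 0%num.

(** Both subtries continue from the list accumulated above them, so sets that agree on their first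
    goods share that part of the computation of [splits]. *)
Fixpoint mu_trie (ws : seq N) (l : seq (N * N)) : trie :=
  if ws is w :: ws' then
    Node (mu_trie ws' l)
         (mu_trie ws' ([seq (N.add p.1 w, p.2) | p <- l] ++
                       [seq (p.1, N.add p.2 w) | p <- l]))
  else Leaf (maximin l).

Lemma mu_trieE ws u l : size u = size ws ->
  root_value (foldl child (mu_trie ws l) u) = maximin (splits ws u l).
Proof.
elim: ws u l => [|w ws IHws] [|b u] l //= [szu].
by rewrite -IHws //; case: b.
Qed.

(* The test "agent [me] is content against agent [other]", evaluated while the
   goods are handed out one by one: [me_value] is what [me] has received,
   [mu] the subtrie reached by the goods going to [me] or [other]. *)
Record comparison := Comparison {
  me : nat; other : nat; items : seq N; me_value : N; mu : trie }.

Definition assign (c : comparison) (o : nat) : comparison :=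
  Comparison (me c) (other c) (behead (items c))
    (if o == me c then N.add (me_value c) (head 0%num (items c)) else me_value c)
    (child (mu c) ((o == me c) || (o == other c))).

(** Closed form of the incremental evaluation: the value becomes the load of the goods owned by
    [me], and the trie is descended along the union of the two bundles. *)
Lemma foldl_assign c s : foldl assign c s =
  Comparison (me c) (other c) (drop (size s) (items c))
    (N.add (me_value c) (load (items c) [seq o == me c | o <- s]))
    (foldl child (mu c) [seq (o == me c) || (o == other c) | o <- s]).
Proof.
elim: s c => [|o s IHs] [i j ws v t] /=.
  by rewrite drop0; case: ws => *; rewrite N.add_0_r.
rewrite IHs /=; case: ws => [|w ws] /=.
  by rewrite !N.add_0_r; case: ifP.
by rewrite N.add_assoc; case: ifP; rewrite ?N.add_0_r.
Qed.

(** Division is avoided by cross-multiplication. The positivity test matches the pairs over which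
    [PMMS_factor] takes its minimum. *)
Definition violated (c : comparison) : bool :=
  N.ltb 0 (root_value (mu c)) &&
  N.leb (N.mul 227 (me_value c)) (N.mul 226 (root_value (mu c))).

Definition fulfilled (c : comparison) : bool :=
  N.leb (N.mul 226 (root_value (mu c))) (N.mul 227 (me_value c)).

Lemma violatedE c : violated c =
  ((0 < root_value (mu c)) && (227 * me_value c <= 226 * root_value (mu c)))%N.
Proof. by rewrite /violated; lia. Qed.

Lemma fulfilledE c : fulfilled c = (226 * root_value (mu c) <= 227 * me_value c)%N.
Proof. by rewrite /fulfilled; lia. Qed.

(** * Exhaustive search over the owners of the goods *)

Fixpoint always_violated n (cs : seq comparison) : bool :=
  if n is n'.+1 then
    all (fun o => always_violated n' [seq assign c o | c <- cs]) [:: 0; 1; 2]%N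
  else has violated cs.

Lemma always_violatedP n cs s : always_violated n cs -> size s = n ->
  all (fun o => o < 3)%N s -> has violated [seq foldl assign c s | c <- cs].
Proof.
elim: n cs s => [|n IHn] cs [|o s] //=; first by rewrite map_id.
move=> /and4P[h0 h1 h2 _] [szs] /andP[o3 s3].
have ho : always_violated n [seq assign c o | c <- cs].
  by case: o o3 => [|[|[|]]].
by have := IHn _ _ ho szs s3; rewrite -map_comp.
Qed.

(** * The explicit data and the two computations *)

Definition weights (i : nat) : seq N := nth [::] [::
  [:: 55; 72; 97; 62; 77; 40; 67; 33; 73];
  [:: 47; 62; 98; 56; 96; 52; 59; 32; 70];
  [:: 59; 78; 84; 80; 101; 67; 79; 10; 64]]%num i.

Definition start (p : nat * nat) : comparison :=
  Comparison p.1 p.2 (weights p.1) 0 (mu_trie (weights p.1) [:: (0, 0)%num]).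

Definition pairs : seq (nat * nat) :=
  [:: (0, 1); (0, 2); (1, 0); (1, 2); (2, 0); (2, 1)]%N.

Lemma always_violated_start : always_violated 9 [seq start p | p <- pairs].
Proof. by vm_compute. Qed.

(** An optimal allocation, with bundles {0, 1, 4}, {2, 7, 8} and {3, 5, 6}; it witnesses the lower
    bound 226/227. *)
Definition best_owners : seq nat := [:: 0; 0; 1; 2; 0; 2; 2; 1; 1]%N.

Lemma fulfilled_best_owners :
  all (fun p => fulfilled (foldl assign (start p) best_owners)) pairs.
Proof. by vm_compute. Qed.

Lemma mem_pairs (i j : 'I_3) : ((i : nat, j : nat) \in pairs) = (i != j).
Proof. by case: i => [[|[|[|i]]] hi]; case: j => [[|[|[|j]]] hj]. Qed.

Lemma size_weights (i : 'I_3) : size (weights i) = 9.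
Proof. by case: i => [[|[|[|i]]] hi]. Qed.

(** * Transfer of the computations to the instance *)

Section Example.
Variable R : realType.

Definition weight (i : 'I_3) (g : 'I_9) : nat := nth 0%num (weights i) g.

Lemma weight_gt0 i g : (0 < weight i g)%N.
Proof.
by case: i => [[|[|[|i]]] hi]; case: g => [[|[|[|[|[|[|[|[|[|g]]]]]]]]] hg].
Qed.

Definition value (i : 'I_3) (S : {set 'I_9}) : R :=
  \sum_(g in S) (weight i g)%:R.

Lemma value_ge0 i S : 0 <= value i S.
Proof. by apply: sumr_ge0 => g _; apply: ler0n. Qed.

Lemma value_set1 i g : value i [set g]%SET = (weight i g)%:R.
Proof. by rewrite /value big_set1. Qed.

Lemma value_additive i S : value i S = \sum_(g in S) value i [set g]%SET.
Proof. by apply: eq_bigr => g _; rewrite value_set1. Qed.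

Definition example : instance R :=
  @Instance R 3 isT 'I_9 value value_ge0 value_additive.

Lemma valueE i S : value i S = (load (weights i) (charvec (mem S)) : nat)%:R.
Proof. by rewrite load_charvec natr_sum. Qed.

Lemma min_loads i (S T : {set 'I_9}) :
  Num.min (value i S) (value i T) =
  (N.min (load (weights i) (charvec (mem S)))
         (load (weights i) (charvec (mem T))) : nat)%:R.
Proof.
rewrite !valueE -natr_min; congr (_%:R).
by rewrite minEnat; lia.
Qed.

(** By [splits_mem] every bipartition of [U] appears in the list, which bounds [mu2] above; by
    [splits_inv] the largest entry comes from a bipartition, which bounds it below. *)
Lemma mu2E (i : 'I_3) (U : {set 'I_9}) : @mu2 R example i U =
  (maximin (splits (weights i) (charvec (mem U)) [:: (0, 0)%num]) : nat)%:R.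
Proof.
set l := splits _ _ _.
apply/le_anti/andP; split.
  apply/bigmax_leP; split; first exact: ler0n.
  move=> [P Q] /andP[/= /eqP PQU dPQ]; rewrite /= min_loads ler_nat.
  have PU : meetb (charvec (mem U)) (charvec (mem P)) = charvec (mem P).
    rewrite meetb_charvec; apply: eq_charvec => g /=.
    by rewrite -PQU inE; case: (g \in P); rewrite ?andbF.
  have QU : diffb (charvec (mem U)) (charvec (mem P)) = charvec (mem Q).
    rewrite diffb_charvec; apply: eq_charvec => g /=; rewrite -PQU inE.
    case gP: (g \in P) => /=; last by rewrite andbT.
    by rewrite (disjointFr dPQ gP).
  have := @splits_mem (weights i) (charvec (mem U)) (charvec (mem P))
    [:: (0, 0)%num] (0, 0)%num.
  rewrite mem_head !size_charvec size_weights PU QU !N.add_0_l => /(_ _ _ _).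
  by move=> /(_ isT erefl erefl)/maximin_ge.
have [->|[x xl ->]] := maximin_attained l.
  exact: bigmax_ge_id.
have [|p] := splits_inv xl; first by rewrite size_charvec size_weights.
rewrite inE => /eqP-> [b szb ->]; rewrite !N.add_0_l /=.
(* [b] may have bits outside [U]; intersecting with [U] yields the first part of a genuine
   bipartition. *)
pose P := [set g : 'I_9 | (g \in U) && nth false b g]%SET.
have -> : b = charvec (fun g : 'I_9 => nth false b g).
  by apply: charvecE; rewrite // szb size_weights.
rewrite meetb_charvec diffb_charvec.
have -> : charvec (fun g => mem U g && nth false b g) = charvec (mem P).
  by apply: eq_charvec => g /=; rewrite inE.
have -> : charvec (fun g => mem U g && ~~ nth false b g) = charvec (mem (U :\: P)%SET).
  apply: eq_charvec => g /=; rewrite !inE.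
  by case: (g \in U); rewrite ?andbF ?andbT.
rewrite -min_loads.
apply: (@le_bigmax_cond _ _ _ 0 (P, (U :\: P)%SET)).
apply/andP; split=> /=.
- by apply/eqP/setP => g; rewrite !inE; case: (g \in U) (nth false b g) => [] [].
- rewrite -finset.setI_eq0; apply/eqP/setP => g; rewrite !inE.
  by case: (g \in U) (nth false b g) => [] [].
Qed.

(* [s] lists the owners of the goods. *)
Lemma final_comparison (X : {ffun 'I_3 -> {set 'I_9}}) (s : seq nat) (i j : 'I_3) :
  size s = 9 -> (forall k (g : 'I_9), (g \in X k) = (nth 0%N s g == k)) ->
  let c := foldl assign (start (i : nat, j : nat)) s in
  value i (X i) = (me_value c : nat)%:R /\
  @mu2 R example i (X i :|: X j)%SET = (root_value (mu c) : nat)%:R.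
Proof.
move=> szs sX; rewrite foldl_assign /=.
have charX (k : 'I_3) : [seq o == (k : nat) | o <- s] = charvec (mem (X k)).
  apply: charvecE; rewrite ?size_map // => g.
  by rewrite (nth_map 0%N) ?szs //= sX.
rewrite valueE charX mu2E; split=> //.
have charU : [seq (o == (i : nat)) || (o == (j : nat)) | o <- s]
    = charvec (mem (X i :|: X j)%SET).
  apply: charvecE; rewrite ?size_map // => g.
  by rewrite (nth_map 0%N) ?szs //= inE !sX.
by rewrite charU mu_trieE // size_charvec size_weights.
Qed.

Lemma owners (X : {ffun 'I_3 -> {set 'I_9}}) : @is_allocation R example X ->
  exists s : seq nat, [/\ size s = 9, all (fun o => o < 3)%N s &
    forall k (g : 'I_9), (g \in X k) = (nth 0%N s g == k)].
Proof.
move=> /andP[/eqP coverX /forallP trivX].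
(* The bundles cover all goods, so the [pick] succeeds; disjointness makes its result the only
   owner. *)
pose owner (g : 'I_9) : 'I_3 := odflt ord0 [pick k | g \in X k].
exists [seq (owner g : nat) | g <- enum 'I_9]; split.
- by rewrite size_map size_enum_ord.
- by apply/allP => o /mapP[g _ ->].
- move=> k g; rewrite (nth_map g) ?size_enum_ord // nth_ord_enum.
  rewrite (inj_eq val_inj) /owner; case: pickP => /= [k' gk' | none].
    apply/idP/eqP => [gk | <- //]; apply/eqP; apply: contraT => k'k.
    have /forallP/(_ k)/implyP/(_ k'k) disj := trivX k'.
    by rewrite (disjointFr disj gk') in gk.
  have : g \in [set: 'I_9]%SET by rewrite inE.
  by rewrite -coverX => /finset.bigcupP[k' _ gk']; have := none k'; rewrite /= gk'.
Qed.

Lemma allocation_violated (X : {ffun 'I_3 -> {set 'I_9}}) :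
  @is_allocation R example X ->
  exists i j : 'I_3, [/\ i != j, 0 < @mu2 R example i (X i :|: X j)%SET &
    227 * value i (X i) <= 226 * @mu2 R example i (X i :|: X j)%SET].
Proof.
move=> /owners[s [szs s3 sX]].
have := always_violatedP always_violated_start szs s3.
rewrite -map_comp has_map => /hasP[[a b] ab /= viol].
have /allP/(_ _ ab)/andP[/= a3 b3] : all (fun p => (p.1 < 3) && (p.2 < 3))%N pairs.
  by [].
exists (Ordinal a3), (Ordinal b3).
have [-> ->] := final_comparison (Ordinal a3) (Ordinal b3) szs sX.
move: viol; rewrite violatedE => /andP[pos le].
by rewrite -mem_pairs ab ltr0n -!natrM ler_nat.
Qed.

Definition best : {ffun 'I_3 -> {set 'I_9}} :=
  [ffun k : 'I_3 => [set g : 'I_9 | nth 0%N best_owners g == k]%SET].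

Lemma best_allocation : @is_allocation R example best.
Proof.
apply/andP; split.
  apply/eqP/setP => g; rewrite inE; apply/bigcupP.
  have o3 : (nth 0 best_owners g < 3)%N
    by case: g => [[|[|[|[|[|[|[|[|[|g]]]]]]]]] hg].
  by exists (Ordinal o3); rewrite // ffunE inE.
apply/forallP => i; apply/forallP => j; apply/implyP => ij.
rewrite -finset.setI_eq0; apply/eqP/setP => g; rewrite !ffunE !inE.
by apply: contraNF ij => /andP[/eqP gi /eqP gj]; apply/eqP/val_inj; rewrite /= -gi -gj.
Qed.

Lemma best_fulfilled (i j : 'I_3) : i != j ->
  226 * @mu2 R example i (best i :|: best j)%SET <= 227 * value i (best i).
Proof.
rewrite -mem_pairs => ij.
have [|->->] := @final_comparison best best_owners i j erefl.
  by move=> k g; rewrite ffunE inE.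
rewrite -!natrM ler_nat -fulfilledE.
exact: (allP fulfilled_best_owners _ ij).
Qed.

Lemma opt_factor_example : opt_factor example = (226 / 227)%:E.
Proof.
apply/le_anti/andP; split.
  apply/bigmax_leP; split; first exact: leNye.
  move=> X /allocation_violated[i [j [ij pos viol]]].
  (* The violated pair has positive [mu2], so its ratio is one of the terms of the minimum. *)
  apply: (@le_trans _ _ (value i (X i) / @mu2 R example i (X i :|: X j)%SET)%:E).
    by apply: (@bigmin_le_cond _ _ _ _ (i, j)); rewrite /= ij.
  by rewrite lee_fin ler_pdivrMr // mulrAC ler_pdivlMr // mulrC.
apply: (le_trans _ (le_bigmax_cond _ _ best_allocation)).
apply/bigmin_geP; split; first exact: leey.
move=> [i j] /andP[/= ij pos].
by rewrite lee_fin ler_pdivlMr // mulrAC ler_pdivrMr // [leRHS]mulrC best_fulfilled.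
Qed.

(** For the violated pair, exactness would give 227 mu <= 227 v <= 226 mu, contradicting mu > 0. *)
Lemma example_no_exact_PMMS (X : {ffun 'I_3 -> {set 'I_9}}) :
  @is_allocation R example X -> ~ @exact_PMMS R example X.
Proof.
move=> /allocation_violated[i [j [ij pos viol]]] /(_ i j ij).
rewrite mul1r /=; lra.
Qed.

End Example.

Theorem theorem17 (R : realType) :
  (exists I : instance R,
    [/\ nagents I = 3%N,
        #|goods I| = 9%N,
        (forall (i : 'I_(nagents I)) (g : goods I),
           0 < valuation i [set g]%SET),
        ~ (exists X : {ffun 'I_(nagents I) -> {set goods I}},
             is_allocation X /\ exact_PMMS X)
      & opt_factor I = (226 / 227)%:E])
  /\ (alpha_star_PMMS R <= (226 / 227)%:E)%E
  /\ 226 / 227 < 1 :> R.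
Proof.
split; [|split].
- exists (example R); split=> //.
  + by rewrite card_ord.
  + by move=> i g; rewrite [valuation _ _]value_set1 ltr0n weight_gt0.
  + by move=> [X [allocX exactX]]; apply: example_no_exact_PMMS allocX exactX.
  + exact: opt_factor_example.
- apply: ereal_inf_lbound; exists (example R).
  by rewrite opt_factor_example.
- lra.
Qed.
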